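(* Let $n\in\mathbb{N}$, $n\ge 1$. Every 2-local derivation on the Witt algebra $W_n=\mathrm{Der}(\mathbb{C}[t_1^{\pm1},\ldots,t_n^{\pm1}])$ is a derivation of the Lie algebra $W_n$ (in particular it is linear).
   Context: All algebras are over $\mathbb{C}$. A derivation on a Lie algebra $L$ is a linear map $D:L\to L$ with $D([x,y])=[D(x),y]+[x,D(y)]$ for all $x,y\in L$. A 2-local derivation on $L$ is a map $\Delta:L\to L$ (not necessarily linear) such that for every $x,y\in L$ there exists a derivation $D_{x,y}:L\to L$ with $\Delta(x)=D_{x,y}(x)$ and $\Delta(y)=D_{x,y}(y)$. Let $A_n=\mathbb{C}[t_1^{\pm1},\ldots,t_n^{\pm1}]$ be the Laurent polynomial algebra and $W_n=\mathrm{Der}(A_n)$ the Lie algebra of its $\mathbb{C}$-derivations under the commutator. It is a free $A_n$-module with basis $d_i=t_i\frac{\partial}{\partial t_i}$, $i=1,\ldots,n$. With $t^\alpha=t_1^{\alpha_1}\cdots t_n^{\alpha_n}$ for $\alpha\in\mathbb{Z}^n$, the bracket is $[t^\alpha d_i,t^\beta d_j]=\beta_i t^{\alpha+\beta}d_j-\alpha_j t^{\alpha+\beta}d_i$. *)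

(* Defs.v *)
From HB Require Import structures.
From mathcomp Require Import all_boot all_algebra.
From mathcomp Require Import finmap monalg.
From mathcomp Require Import boolp functions reals complex.

Set Implicit Arguments.
Unset Strict Implicit.
Unset Printing Implicit Defensive.

Import GRing.Theory.
Local Open Scope ring_scope.

(* [laurent K n] is K[t_1^{+-1}, ..., t_n^{+-1}]: finitely supported functions
   on Z^n, where << a >> stands for the monomial t^a. The ring structure of
   monalg does not apply because monomType excludes nontrivial invertible
   monomials; only the K-module structure of malg is reused. *)
Definition laurent (K : comNzRingType) (n : nat) : predArgType :=
  {malg K['rV[int]_n]}.

Section LaurentRing.
Variables (K : comNzRingType) (n : nat).

Local Notation A := (laurent K n).
Local Notation Z := 'rV[int]_n.

HB.instance Definition _ := GRing.Lmodule.on A.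

Implicit Types (f g h : A) (a b : Z).

Definition laurent_one : A := << 1 *g (0 : Z) >>.

Definition laurent_mul f g : A :=
  \sum_(a <- msupp f) \sum_(b <- msupp g) << f@_a * g@_b *g (a + b)%R >>.

Lemma laurent_mulEw (d1 d2 : {fset Z}) f g :
  (msupp f `<=` d1)%fset -> (msupp g `<=` d2)%fset ->
  laurent_mul f g =
    \sum_(a <- d1) \sum_(b <- d2) << f@_a * g@_b *g (a + b)%R >>.
Proof.
move=> le1 le2; rewrite /laurent_mul (big_fset_incl _ le1) /=.
  apply/eq_bigr=> a _; apply/big_fset_incl => // b _ /mcoeff_outdom ->.
  by rewrite mulr0 monalgU0.
move=> a _ /mcoeff_outdom fa.
by rewrite big1 // => b _; rewrite fa mul0r monalgU0.
Qed.

Lemma laurent_mulC : commutative laurent_mul.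
Proof.
move=> f g; rewrite /laurent_mul exchange_big /=.
by apply/eq_bigr=> b _; apply/eq_bigr=> a _; rewrite mulrC addrC.
Qed.

Lemma laurent_mulUU (c1 c2 : K) a b :
  laurent_mul << c1 *g a >> << c2 *g b >> = << c1 * c2 *g (a + b)%R >>.
Proof.
by rewrite (laurent_mulEw msuppU_le msuppU_le) !big_seq_fset1 !mcoeffUU.
Qed.

Lemma laurent_mulDl : left_distributive laurent_mul +%R.
Proof.
move=> f g h; pose d := (msupp f `|` msupp g)%fset.
rewrite (laurent_mulEw (msuppD_le f g) (fsubset_refl _)).
rewrite (laurent_mulEw (fsubsetUl (msupp f) (msupp g)) (fsubset_refl _)).
rewrite (laurent_mulEw (fsubsetUr (msupp f) (msupp g)) (fsubset_refl _)).
rewrite -big_split /=; apply/eq_bigr=> a _.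
rewrite -big_split /=; apply/eq_bigr=> b _.
by rewrite mcoeffD mulrDl monalgUD.
Qed.

Lemma laurent_mulDr : right_distributive laurent_mul +%R.
Proof. by move=> f g h; rewrite !(laurent_mulC f) laurent_mulDl. Qed.

Lemma laurent_mul0l : left_zero 0 laurent_mul.
Proof. by move=> f; rewrite /laurent_mul msupp0 big_seq_fset0. Qed.

Lemma laurent_mul0r : right_zero 0 laurent_mul.
Proof. by move=> f; rewrite laurent_mulC laurent_mul0l. Qed.

Lemma laurent_mul_suml (I : Type) (r : seq I) (F : I -> A) g :
  laurent_mul (\sum_(i <- r) F i) g = \sum_(i <- r) laurent_mul (F i) g.
Proof.
exact: (big_morph (laurent_mul^~ g) (fun _ _ => laurent_mulDl _ _ _)
          (laurent_mul0l _)).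
Qed.

Lemma laurent_mul_sumr (I : Type) (r : seq I) (F : I -> A) g :
  laurent_mul g (\sum_(i <- r) F i) = \sum_(i <- r) laurent_mul g (F i).
Proof.
exact: (big_morph (laurent_mul g) (fun _ _ => laurent_mulDr _ _ _)
          (laurent_mul0r _)).
Qed.

Lemma laurent_mulA : associative laurent_mul.
Proof.
move: laurent_mul (@laurent_mul_suml) (@laurent_mul_sumr) laurent_mulUU.
move=> m suml sumr mUU f g h.
rewrite [f]monalgE !suml; apply/eq_bigr=> a _.
rewrite [g]monalgE sumr !suml sumr; apply/eq_bigr=> b _.
rewrite [h]monalgE !sumr; apply/eq_bigr=> c _.
by rewrite !mUU mulrA addrA.
Qed.

Lemma laurent_mul1l : left_id laurent_one laurent_mul.
Proof.
move=> f; rewrite {1}[f]monalgE laurent_mul_sumr [RHS]monalgE.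
by apply/eq_bigr=> a _; rewrite laurent_mulUU mul1r add0r.
Qed.

Lemma laurent_one_neq0 : laurent_one != 0.
Proof.
by apply/eqP=> /malgP/(_ 0) /eqP; rewrite mcoeffUU mcoeff0 oner_eq0.
Qed.

HB.instance Definition _ := GRing.Zmodule_isComNzRing.Build A
  laurent_mulA laurent_mulC laurent_mul1l laurent_mulDl laurent_one_neq0.

Lemma laurent_scaleAl (c : K) f g : c *: (f * g) = (c *: f) * g.
Proof.
have scaleE (h : A) : c *: h = (<< c *g (0 : Z) >> : A) * h.
  rewrite {2}[h]monalgE [RHS]laurent_mul_sumr malgZ_def.
  by apply/eq_bigr=> a _; rewrite laurent_mulUU add0r.
by rewrite !scaleE mulrA.
Qed.

HB.instance Definition _ := GRing.Lmodule_isLalgebra.Build K A laurent_scaleAl.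
HB.instance Definition _ := GRing.Lalgebra_isComAlgebra.Build K A.

End LaurentRing.

(* Derivations with respect to an arbitrary product [mul]; used with the
   product of an associative algebra and with a Lie bracket. *)
Definition is_derivation (K : comNzRingType) (V : lmodType K)
    (mul : V -> V -> V) (D : V -> V) : Prop :=
  linear D /\ forall x y, D (mul x y) = mul (D x) y + mul x (D y).

HB.mixin Record Lmodule_isLieAlgebra (K : comNzRingType) (L : Type)
    of GRing.Lmodule K L := {
  lie : L -> L -> L;
  lie_linear_l : forall y, linear (lie^~ y);
  lie_linear_r : forall x, linear (lie x);
  lie_alt : forall x, lie x x = 0;
  lie_jacobi : forall x y z,
    lie x (lie y z) + lie y (lie z x) + lie z (lie x y) = 0
}.

#[short(type="lieAlgType")]
HB.structure Definition LieAlgebra (K : comNzRingType) :=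
  {L of GRing.Lmodule K L & Lmodule_isLieAlgebra K L}.

Definition lie_derivation (K : comNzRingType) (L : lieAlgType K)
    (D : L -> L) : Prop :=
  is_derivation (@lie K L) D.

Definition two_local_derivation (K : comNzRingType) (L : lieAlgType K)
    (Delta : L -> L) : Prop :=
  forall x y : L, exists D : L -> L,
    [/\ lie_derivation D, Delta x = D x & Delta y = D y].

Section Der.
Variables (K : comNzRingType) (A : algType K).

Definition der_pred : {pred (A -> A)} :=
  fun D => `[< is_derivation (@GRing.mul A) D >].

Lemma der_predP (D : A -> A) :
  reflect (is_derivation *%R D) (D \in der_pred).
Proof. exact: asboolP. Qed.

Lemma der_submod_closed : submod_closed der_pred.
Proof.
split.
  by apply/der_predP; split=> [c x y|x y] /=; rewrite ?scaler0 ?mul0r ?mulr0 addr0.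
move=> c D E /der_predP[Dl DM] /der_predP[El EM]; apply/der_predP.
have fE f : (c *: D + E) f = c *: D f + E f by [].
split=> [k x y|x y]; rewrite !fE.
  by rewrite Dl El !scalerDr !scalerA (mulrC c) addrACA.
by rewrite DM EM scalerDr mulrDl mulrDr -scalerAl -scalerAr addrACA.
Qed.

HB.instance Definition _ :=
  GRing.isSubmodClosed.Build K (A -> A) der_pred der_submod_closed.

Record Der : predArgType := MkDer {
  der_val :> A -> A;
  der_valP : der_val \in der_pred
}.

HB.instance Definition _ := [isSub for der_val].
HB.instance Definition _ := [Choice of Der by <:].
HB.instance Definition _ := [SubChoice_isSubLmodule of Der by <:].

Lemma der_commutator_subproof (D E : Der) :
  (fun f => D (E f) - E (D f)) \in der_pred.
Proof.
have /der_predP[Dl DM] := der_valP D; have /der_predP[El EM] := der_valP E.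
have DD x y : D (x + y) = D x + D y by have := Dl 1 x y; rewrite !scale1r.
have ED x y : E (x + y) = E x + E y by have := El 1 x y; rewrite !scale1r.
apply/der_predP; split=> [k x y|x y].
  by rewrite El Dl Dl El scalerBr opprD addrACA.
rewrite DM EM DD ED !DM !EM mulrBl mulrBr.
set a := D (E x) * y; set b := E x * D y; set c := D x * E y.
set d := x * D (E y); set e := E (D x) * y; set u := x * E (D y).
rewrite [a + b]addrC [e + c]addrC (addrACA b) (addrACA c) [c + b]addrC.
by rewrite opprD [LHS]addrACA subrr add0r opprD addrACA.
Qed.

Definition der_lie (D E : Der) : Der := MkDer (der_commutator_subproof D E).

Lemma der_ext (D E : Der) : D =1 E -> D = E.
Proof. by move=> DE; apply/val_inj/funext. Qed.

Lemma der_addE (D E : Der) f : (D + E) f = D f + E f.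
Proof. by []. Qed.

Lemma der_scaleE (c : K) (D : Der) f : (c *: D) f = c *: D f.
Proof. by []. Qed.

Lemma der_lieE (D E : Der) f : der_lie D E f = D (E f) - E (D f).
Proof. by []. Qed.

Lemma der_linear_l (E : Der) : linear (der_lie^~ E).
Proof.
move=> c D D'; have /der_predP[El _] := der_valP E; apply: der_ext => f.
by rewrite !(der_addE, der_scaleE, der_lieE) El scalerBr opprD addrACA.
Qed.

Lemma der_linear_r (D : Der) : linear (der_lie D).
Proof.
move=> c E E'; have /der_predP[Dl _] := der_valP D; apply: der_ext => f.
by rewrite !(der_addE, der_scaleE, der_lieE) Dl scalerBr opprD addrACA.
Qed.

Lemma der_lie_alt (D : Der) : der_lie D D = 0.
Proof. by apply: der_ext => f; rewrite der_lieE subrr. Qed.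

Lemma der_lie_jacobi (D E F : Der) :
  der_lie D (der_lie E F) + der_lie E (der_lie F D) + der_lie F (der_lie D E)
  = 0.
Proof.
have derB (G : Der) x y : G (x - y) = G x - G y.
  have /der_predP[Gl _] := der_valP G.
  by rewrite addrC -scaleN1r Gl scaleN1r addrC.
apply: der_ext => f; rewrite !(der_addE, der_lieE) !derB !opprD !opprK.
set a := D (E (F f)); set b := D (F (E f)); set c := E (F (D f)).
set d := F (E (D f)); set e := E (D (F f)); set g := F (D (E f)).
rewrite (addrACA a (- b)) (addrACA c (- e)) (addrACA g (- d)).
rewrite (addrC (- b)) (addrC (- e)) (addrC (- d)).
rewrite (addrACA (a - c)) (addrACA (a - c + (c - g))).
by rewrite !subrKA !subrr addr0.
Qed.

HB.instance Definition _ := Lmodule_isLieAlgebra.Build K Der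
  der_linear_l der_linear_r der_lie_alt der_lie_jacobi.

End Der.

(* The complex numbers are R[i] for R : realType, which determines R up to a
   unique isomorphism. *)
Definition witt (R : realType) (n : nat) : lieAlgType R[i] :=
  Der (laurent R[i] n).

(* Main.v *)
Require Import Defs.
From HB Require Import structures.
From mathcomp Require Import all_boot all_order all_algebra.
From mathcomp Require Import finmap monalg.
From mathcomp Require Import boolp classical_sets reals complex polyrcf.
From mathcomp Require Import ring lra.

Set Implicit Arguments.
Unset Strict Implicit.
Unset Printing Implicit Defensive.

Import Order.TTheory GRing.Theory Num.Theory.
Local Open Scope ring_scope.

(** Write t^a d_u for the derivation t^b |-> <u, b> t^(a+b) of Laurent
    polynomials, where u is a vector of scalars, a and b are integer vectors
    and <u, b> = sum_i u_i b_i. These derivations span the Witt algebra, and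
      [t^a d_u, t^b d_v] = t^(a+b) d_(<u, b> v - <v, a> u).
    Fix a vector mu whose coordinates are linearly independent over the
    integers. Such a vector exists: take the powers of a transcendental real
    number ([exists_generic]). The brackets with d_mu then tell all degrees
    apart.

    Every derivation D of the Witt algebra is inner ([derivation_inner]).
    After subtracting an inner derivation, D kills d_mu, hence preserves
    degrees, D (t^a d_u) = t^a d_(phi_a u). The derivation rule for the pairs
    of degrees a, b forces phi_a to be a scalar l(a) and l to be additive in a,
    so that D is the bracket with some d_h ([derivation_cartan]).

    Let Delta be a 2-local derivation; subtracting a derivation, assume
    Delta(d_mu) = 0. Applied to the pairs (x, d_mu), 2-locality gives, for
    each x, a vector h_x such that Delta(x) = [d_(h_x), x]; it remains to make
    h_x independent of x. For this, compare x with y_a = d_mu + t^a d_mu,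
    where a = k b is a large multiple of a degree b that occurs in x. Here
    Delta(y_a) = l_a t^a d_mu for some scalar l_a. A derivation agreeing with
    Delta on both x and y_a is ad g for some g with [g, y_a] = l_a t^a d_mu,
    and this equation forces g = c y_a + d_h with <h, a> = l_a
    ([test_elt_centralizer]). If c were nonzero, the largest multiple m b
    occurring in x would produce in [g, x] a nonzero component of degree
    m b + a, a degree that Delta(x) cannot reach. So c = 0, and Delta
    multiplies the component of x of degree b by l_(kb) / k, whatever x is, as
    soon as k is large ([two_local_rate]). Reading off the multipliers on
    one element whose degrees include all the unit vectors and one further
    degree shows that they depend additively on the degree, that is,
    Delta = ad d_h for a single h ([two_local_inner]). *)

(** * Derivations of Lie algebras *)
Section LieAlgebra.
Variables (K : comNzRingType) (L : lieAlgType K).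
Implicit Types (x y z : L) (D E : L -> L).

Lemma lieDl x y z : lie (x + y) z = lie x z + lie y z.
Proof. by have := lie_linear_l z 1 x y; rewrite !scale1r. Qed.

Lemma lieDr x y z : lie x (y + z) = lie x y + lie x z.
Proof. by have := lie_linear_r x 1 y z; rewrite !scale1r. Qed.

Lemma lie_anti x y : lie x y = - lie y x.
Proof.
apply/eqP; rewrite -addr_eq0; apply/eqP.
by have := lie_alt (x + y); rewrite lieDl !lieDr !lie_alt add0r addr0.
Qed.

Lemma lie0l x : lie 0 x = 0.
Proof. by apply: (addrI (lie 0 x)); rewrite -lieDl !addr0. Qed.

Lemma lieZl c x y : lie (c *: x) y = c *: lie x y.
Proof. by have := lie_linear_l y c x 0; rewrite !addr0 lie0l addr0. Qed.

Lemma lieZr c x y : lie x (c *: y) = c *: lie x y.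
Proof. by rewrite lie_anti lieZl -scalerN -lie_anti. Qed.

Lemma lieNr x y : lie x (- y) = - lie x y.
Proof. by rewrite -scaleN1r lieZr scaleN1r. Qed.

Lemma lie_derivation_ad x : lie_derivation (lie x).
Proof.
split=> [|y z]; first exact: lie_linear_r.
have /eqP := lie_jacobi x y z.
rewrite -addrA addr_eq0 => /eqP ->.
by rewrite opprD addrC [lie z _]lie_anti opprK [lie z x]lie_anti lieNr opprK.
Qed.

Lemma lie_derivation_comb c D E :
  lie_derivation D -> lie_derivation E ->
  lie_derivation (fun x => c *: D x + E x).
Proof.
move=> [Dl Dm] [El Em]; split=> [k x y|x y].
  by rewrite Dl El !scalerDr !scalerA (mulrC c) addrACA.
by rewrite Dm Em lieDl lieDr lieZl lieZr scalerDr addrACA.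
Qed.

Lemma lie_derivationD D E :
  lie_derivation D -> lie_derivation E -> lie_derivation (fun x => D x + E x).
Proof.
move=> hD hE; have := lie_derivation_comb 1 hD hE.
by rewrite (_ : (fun x => _) = (fun x => D x + E x)) //; apply/funext => x;
  rewrite scale1r.
Qed.

Lemma lie_derivationB D E :
  lie_derivation D -> lie_derivation E -> lie_derivation (fun x => D x - E x).
Proof.
move=> hD hE; have := lie_derivation_comb (-1) hE hD.
rewrite (_ : (fun x => _) = (fun x => D x - E x)) //; apply/funext => x.
by rewrite scaleN1r addrC.
Qed.

End LieAlgebra.

(** * The pairing between scalar vectors and degrees *)
Section Pairing.
Variables (K : numFieldType) (n : nat).
Implicit Types (u v : 'rV[K]_n) (a b : 'rV[int]_n).

Definition dot u a : K := \sum_i u 0 i * (a 0 i)%:~R.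

Lemma dotDl u v a : dot (u + v) a = dot u a + dot v a.
Proof. by rewrite -big_split; apply: eq_bigr => i _; rewrite mxE mulrDl. Qed.

Lemma dotZl c u a : dot (c *: u) a = c * dot u a.
Proof. by rewrite mulr_sumr; apply: eq_bigr => i _; rewrite mxE mulrA. Qed.

Lemma dot0l a : dot 0 a = 0.
Proof. by rewrite -(scale0r 0) dotZl mul0r. Qed.

Lemma dotNl u a : dot (- u) a = - dot u a.
Proof. by rewrite -scaleN1r dotZl mulN1r. Qed.

Lemma dotDr u a b : dot u (a + b) = dot u a + dot u b.
Proof.
by rewrite -big_split; apply: eq_bigr => i _; rewrite mxE intrD mulrDr.
Qed.

Lemma dot0r u : dot u 0 = 0.
Proof. by apply: (addrI (dot u 0)); rewrite -dotDr !addr0. Qed.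

Lemma dotNr u a : dot u (- a) = - dot u a.
Proof. by apply: (addrI (dot u a)); rewrite -dotDr !subrr dot0r. Qed.

Lemma dotMnr u a k : dot u (a *+ k) = k%:R * dot u a.
Proof.
elim: k => [|k IH]; first by rewrite mulr0n dot0r mul0r.
by rewrite mulrS dotDr IH mulrS mulrDl mul1r.
Qed.

Definition unitv (i : 'I_n) : 'rV[int]_n := delta_mx 0 i.

Lemma dot_unitv u i : dot u (unitv i) = u 0 i.
Proof.
rewrite /dot (bigD1 i) //= mxE !eqxx mulr1 big1 ?addr0 // => j ji.
by rewrite mxE (negbTE ji) andbF mulr0.
Qed.

Lemma dot_delta i a : dot (delta_mx 0 i) a = (a 0 i)%:~R.
Proof.
rewrite /dot (bigD1 i) //= mxE !eqxx mul1r big1 ?addr0 // => j ji.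
by rewrite mxE (negbTE ji) andbF mul0r.
Qed.

Lemma dot_inj u : (forall a, dot u a = 0) -> u = 0.
Proof. by move=> h; apply/rowP => i; rewrite -dot_unitv h mxE. Qed.

Lemma row_neq0 (T : zmodType) (a : 'rV[T]_n) : a != 0 -> exists i, a 0 i != 0.
Proof.
move=> a0; apply/existsP; rewrite -negb_forall; apply: contraNN a0.
by move/forallP => h; apply/eqP/rowP => i; rewrite mxE (eqP (h i)).
Qed.

Lemma dot_surj a : a != 0 -> exists u, dot u a = 1.
Proof.
case/row_neq0 => i ai; exists ((a 0 i)%:~R^-1 *: delta_mx 0 i).
by rewrite dotZl dot_delta mulVf // intr_eq0.
Qed.

(** Applied below to the logarithmic derivative of a derivation and to the
    multiplier of a degree. *)
Lemma additive_rowE (V : zmodType) (F : {additive 'rV[int]_n -> V}) a :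
  F a = \sum_i F (unitv i) *~ a 0 i.
Proof.
have {1}-> : a = \sum_i unitv i *~ a 0 i.
  rewrite {1}[a]row_sum_delta; apply: eq_bigr => i _.
  by apply/rowP => j; rewrite -scaler_int !mxE intz.
by rewrite raddf_sum; apply: eq_bigr => i _; rewrite raddfMz.
Qed.

Lemma muln_neq a j k : a != 0 -> j != k -> a *+ j != a *+ k.
Proof.
move=> /row_neq0[r ar]; apply: contraNneq => /rowP/(_ r)/eqP.
by rewrite !mulmxnE -!(mulr_natr (a 0 r)) (inj_eq (mulfI ar)) eqr_nat.
Qed.

(** Linear independence over the integers of the coordinates of [u]. *)
Definition generic (u : 'rV[K]_n) := forall a, dot u a = 0 -> a = 0.
End Pairing.

(** * Laurent monomials *)

HB.lock Definition mon (K : numFieldType) (n : nat) (a : 'rV[int]_n) :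
  laurent K n := << 1 *g a >>.

Section Monomials.
Variables (K : numFieldType) (n : nat).
Local Notation A := (laurent K n).
Local Notation Z := 'rV[int]_n.
Implicit Types (f g : A) (a b d : Z).

Local Notation mon := (@mon K n).

Lemma mcoeff_mon a d : (mon a)@_d = (a == d)%:R.
Proof. by rewrite unlock mcoeffU. Qed.

Lemma monM a b : mon a * mon b = mon (a + b).
Proof. by rewrite unlock [LHS]laurent_mulUU mulr1. Qed.

Lemma mon0 : mon 0 = 1.
Proof. by rewrite unlock. Qed.

Lemma monZE c a : << c *g a >> = c *: mon a :> A.
Proof. by apply/malgP => d; rewrite mcoeffZ mcoeffU mcoeff_mon mulr_natr. Qed.

Lemma monE f : f = \sum_(b <- msupp f) f@_b *: mon b.
Proof. by rewrite {1}[f]monalgE; apply: eq_bigr => b _; rewrite monZE. Qed.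

(** Monomials span, so that identities between derivations, and the Leibniz rule
    itself, need only be tested on them. *)
Lemma eq_on_mon (F G : A -> A) : linear F -> linear G ->
  (forall a, F (mon a) = G (mon a)) -> F =1 G.
Proof.
move=> Fl Gl FG.
pose F' : {linear A -> A} := HB.pack F (GRing.isLinear.Build _ _ _ _ F Fl).
pose G' : {linear A -> A} := HB.pack G (GRing.isLinear.Build _ _ _ _ G Gl).
move=> f; rewrite -[F f]/(F' f) -[G f]/(G' f) [f]monE !linear_sum.
by apply: eq_bigr => b _; rewrite !linearZ /= FG.
Qed.

Lemma mcoeff_monM a f d : (mon a * f)@_d = f@_(d - a).
Proof.
rewrite [f in LHS]monE [f in RHS]monE mulr_sumr !raddf_sum /=;
  apply: eq_bigr => b _.
rewrite -scalerAr monM !mcoeffZ !mcoeff_mon; congr (_ * (nat_of_bool _)%:R).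
by rewrite [RHS]eq_sym subr_eq addrC eq_sym.
Qed.
End Monomials.

(** * Homogeneous components of derivations *)

(** The operator t^a d_u. *)
HB.lock Definition homog_fun (K : numFieldType) (n : nat) (a : 'rV[int]_n)
    (u : 'rV[K]_n) (f : laurent K n) : laurent K n :=
  \sum_(b <- msupp f) << f@_b * dot u b *g a + b >>.

(** If [u] is the component of [x] of degree [a], then t^a d_u maps t^(e_i) to
    u_i t^(a + e_i); the i-th coordinate is read there. *)
HB.lock Definition wcomp (K : numFieldType) (n : nat) (x : Der (laurent K n))
    (a : 'rV[int]_n) : 'rV[K]_n :=
  \row_i (x (mon K (unitv i)))@_(a + unitv i).

Section Coordinates.
Variables (K : numFieldType) (n : nat).
Local Notation A := (laurent K n).
Local Notation W := (Der A).
Local Notation Z := 'rV[int]_n.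
Implicit Types (x y z : W) (a b d : Z) (u v : 'rV[K]_n).

Lemma der_linear x : linear x.
Proof. by have /der_predP[] := der_valP x. Qed.

HB.instance Definition _ x := GRing.isLinear.Build K A A *:%R x (der_linear x).

Lemma derM x (f g : A) : x (f * g) = x f * g + f * x g.
Proof. by have /der_predP[_ ->] := der_valP x. Qed.

Lemma der_eq_mon x y : (forall a, x (mon K a) = y (mon K a)) -> x = y.
Proof. by move=> h; apply: der_ext; apply: eq_on_mon h; apply: der_linear. Qed.

Local Notation wcomp := (@wcomp K n).

Lemma wcomp_coord x a i : wcomp x a 0 i = (x (mon K (unitv i)))@_(a + unitv i).
Proof. by rewrite unlock mxE. Qed.

(** The logarithmic derivative. The Leibniz rule on monomials says that it is
    additive in the exponent, which is why a derivation is determined by its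
    values on the variables. *)
Definition dlog x a : A := mon K (- a) * x (mon K a).

Lemma der_dlog x a : x (mon K a) = mon K a * dlog x a.
Proof. by rewrite /dlog mulrA monM subrr mon0 mul1r. Qed.

Lemma dlogB x : {morph dlog x : a b / a - b}.
Proof.
move=> a b; apply: (addIr (dlog x b)); rewrite subrK; set c := a - b.
have -> : a = c + b by rewrite subrK.
apply: esym; rewrite {1}/dlog -monM derM (der_dlog x b) opprD -monM.
have cancel_units (R : comNzRingType) (c' c0 b' b0 f g : R) :
    c' * c0 = 1 -> b' * b0 = 1 -> c' * b' * (f * b0 + c0 * (b0 * g)) = c' * f +
      g.
  move=> cc bb; transitivity (c' * f * (b' * b0) + (c' * c0) * (b' * b0) * g).
    ring.
  by rewrite cc bb !mulr1 mul1r.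
by apply: cancel_units; rewrite monM addNr mon0.
Qed.

HB.instance Definition _ x :=
  GRing.isZmodMorphism.Build Z A (dlog x) (dlogB x).

Lemma dlogE x a : dlog x a = \sum_i (a 0 i)%:~R *: dlog x (unitv i).
Proof.
by rewrite additive_rowE; apply: eq_bigr => i _; rewrite scaler_int.
Qed.

Lemma wcomp_dlog x a i : wcomp x a 0 i = (dlog x (unitv i))@_a.
Proof. by rewrite wcomp_coord mcoeff_monM opprK. Qed.

(** This identity says that [x] is the sum of the t^a d_u, with [u] its
    component of degree [a]. *)
Lemma der_monE x a d : (x (mon K a))@_d = dot (wcomp x (d - a)) a.
Proof.
rewrite der_dlog mcoeff_monM dlogE raddf_sum; apply: eq_bigr => i _.
by rewrite /= wcomp_dlog mcoeffZ mulrC.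
Qed.

Lemma wcomp_inj x y : wcomp x =1 wcomp y -> x = y.
Proof.
by move=> h; apply: der_eq_mon => a; apply/malgP => d; rewrite !der_monE h.
Qed.

Lemma wcompD x y a : wcomp (x + y) a = wcomp x a + wcomp y a.
Proof. by apply/rowP => i; rewrite mxE !wcomp_coord der_addE mcoeffD. Qed.

Lemma wcompZ c x a : wcomp (c *: x) a = c *: wcomp x a.
Proof. by apply/rowP => i; rewrite mxE !wcomp_coord der_scaleE mcoeffZ. Qed.

Lemma wcomp0 a : wcomp 0 a = 0.
Proof. by rewrite -(scale0r 0) wcompZ scale0r. Qed.

Lemma wcomp_sum (I : Type) (r : seq I) (F : I -> W) a :
  wcomp (\sum_(i <- r) F i) a = \sum_(i <- r) wcomp (F i) a.
Proof. by apply: (big_morph (wcomp^~ a)) => [x y|];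
  rewrite ?wcompD ?wcomp0. Qed.

Lemma wcomp_finite x : exists S : seq Z, forall a, wcomp x a != 0 -> a \in S.
Proof.
exists [seq b - unitv i | i <- enum 'I_n, b <- enum_fset (msupp (x (mon K
  (unitv i))))].
move=> a /row_neq0[j]; rewrite wcomp_coord mcoeff_neq0 => aj.
by apply/allpairsPdep; exists j, (a + unitv j); rewrite mem_enum aj addrK.
Qed.

Lemma homog_funE a u f d : (homog_fun a u f)@_d = f@_(d - a) * dot u (d - a).
Proof.
rewrite unlock raddf_sum /= (eq_bigr (fun b => (f@_b * dot u b) *+ (b == d -
  a))).
  have [fd|fd] := boolP (d - a \in msupp f).
    rewrite (big_fsetD1 (d - a)) //= eqxx mulr1n big_seq big1 ?addr0 // => b.
    by rewrite in_fsetD1 => /andP[/negbTE ->].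
  rewrite (mcoeff_outdom fd) mul0r big_seq big1 // => b fb.
  by case: eqP => // bd; rewrite bd (negbTE fd) in fb.
move=> b _; rewrite mcoeffU; congr (_ *+ nat_of_bool _).
by rewrite [RHS]eq_sym subr_eq addrC eq_sym.
Qed.

Lemma homog_fun_linear a u : linear (homog_fun a u).
Proof.
move=> c f g; apply/malgP => d.
by rewrite mcoeffD mcoeffZ !homog_funE mcoeffD mcoeffZ mulrDl mulrA.
Qed.

Lemma homog_fun_mon a u b : homog_fun a u (mon K b) = dot u b *: mon K (a + b).
Proof.
apply/malgP => d; rewrite homog_funE mcoeffZ !mcoeff_mon eq_sym subr_eq addrC
  eq_sym.
by case: eqP => [<-|_]; rewrite ?mul0r ?mulr0 // mul1r mulr1 addrAC subrr add0r.
Qed.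

(** Both sides of the Leibniz rule are bilinear, and on t^b and t^c it reads
    <u, b + c> = <u, b> + <u, c>. *)
Lemma homog_subproof a u : homog_fun a u \in @der_pred K A.
Proof.
apply/der_predP; split; first exact: homog_fun_linear.
have lin := homog_fun_linear a u.
set F := homog_fun a u in lin * => f g.
apply: (eq_on_mon (F := fun f => F (f * g)) (G := fun f => F f * g + f * F g)).
- by move=> c h k /=; rewrite mulrDl -scalerAl lin.
- move=> c h k /=; rewrite lin !mulrDl -!scalerAl scalerDr.
  by rewrite addrACA.
move=> b /=.
apply: (eq_on_mon (F := fun g => F (mon K b * g))
                  (G := fun g => F (mon K b) * g + mon K b * F g)).
- by move=> c h k /=; rewrite mulrDr -scalerAr lin.
- move=> c h k /=; rewrite lin !mulrDr -!scalerAr scalerDr.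
  by rewrite addrACA.
rewrite /F => d; rewrite monM !homog_fun_mon -scalerAl -scalerAr !monM dotDr
  scalerDl.
by rewrite addrA [b + (a + d)]addrCA addrA.
Qed.

Definition homog a u : W := MkDer (homog_subproof a u).

Lemma wcomp_homog a u d : wcomp (homog a u) d = if d == a then u else 0.
Proof.
apply/rowP => i; rewrite wcomp_coord /= homog_fun_mon mcoeffZ mcoeff_mon
  dot_unitv.
rewrite (inj_eq (addIr _)) eq_sym.
by case: eqP => _; rewrite ?mulr1 // mulr0 mxE.
Qed.

Lemma wcomp_sum_homog (c : Z -> 'rV[K]_n) (S : seq Z) :
  (forall a, c a != 0 -> a \in S) ->
  wcomp (\sum_(a <- undup S) homog a (c a)) =1 c.
Proof.
move=> cS d.
rewrite wcomp_sum (eq_bigr (fun a => if a == d then c a else 0)); last first.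
  by move=> a _; rewrite wcomp_homog eq_sym.
rewrite -big_mkcond /= -big_filter.
have [dS|dS] := boolP (d \in S).
  by rewrite filter_pred1_uniq ?undup_uniq ?mem_undup // big_seq1.
rewrite big_filter big_seq_cond big1.
  by apply/esym/eqP; apply: contraNT dS => /cS.
by move=> a /andP[]; rewrite mem_undup => aS /eqP ad; rewrite -ad aS in dS.
Qed.

Lemma der_sum_homog x : exists S : seq Z, x = \sum_(a <- S) homog a (wcomp x a).
Proof.
have [S hS] := wcomp_finite x; exists (undup S).
by apply/wcomp_inj => d; rewrite wcomp_sum_homog.
Qed.

Lemma homog_of_wcomp x a : (forall d, d != a -> wcomp x d = 0) -> x = homog a
  (wcomp x a).
Proof.
by move=> h; apply: wcomp_inj => d; rewrite wcomp_homog;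
  case: eqP => [->|/eqP/h].
Qed.

Lemma homog_linear a : linear (homog a).
Proof.
move=> c u v; apply: wcomp_inj => d; rewrite wcompD wcompZ !wcomp_homog.
by case: eqP => _ //; rewrite scaler0 addr0.
Qed.

Lemma wcomp_lie_homog a u x d :
  wcomp (lie (homog a u) x) d =
    dot u (d - a) *: wcomp x (d - a) - dot (wcomp x (d - a)) a *: u.
Proof.
apply/rowP => i; rewrite wcomp_coord der_lieE mcoeffB /= homog_funE
  homog_fun_mon.
rewrite linearZ /= mcoeffZ !der_monE.
have -> : d + unitv i - a - unitv i = d - a by rewrite addrAC addrK.
have -> : d + unitv i - (a + unitv i) = d - a by rewrite opprD addrACA subrr
  addr0.
rewrite [d + _ - a]addrAC !dotDr !dot_unitv !mxE.
ring.
Qed.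

Lemma wcomp_lie_cartan u x d : wcomp (lie (homog 0 u) x) d = dot u d *: wcomp x
  d.
Proof. by rewrite wcomp_lie_homog subr0 dot0r scale0r subr0. Qed.

Lemma lie_homog a b u v :
  lie (homog a u) (homog b v) = homog (a + b) (dot u b *: v - dot v a *: u).
Proof.
apply: wcomp_inj => d; rewrite wcomp_lie_homog !wcomp_homog.
rewrite subr_eq [b + a]addrC; case: eqP => [->|_].
  by rewrite [a + b]addrC addrK.
by rewrite dot0l scaler0 scale0r subr0.
Qed.

(** Finite support, in the form used below: a half-line in the lattice of
    degrees leaves the support. *)
Lemma wcomp_string x a b : b != 0 ->
  exists N, forall k, (N <= k)%N -> wcomp x (a + b *+ k) = 0.
Proof.
case/row_neq0 => i bi; have [S hS] := wcomp_finite x.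
exists (\sum_(s <- S) absz (s 0%R i - a 0%R i)%R)%N.+1 => k Nk; apply/eqP.
apply: contraTT Nk => /hS kS; rewrite -leqNgt.
rewrite (perm_big _ (perm_to_rem kS)) big_cons !mxE [a 0 i + _]addrC addrK.
apply: leq_trans (leq_addr _ _).
by rewrite mulmxnE -mulr_natr abszM natz absz_nat leq_pmull // absz_gt0.
Qed.
End Coordinates.

(** * Derivations of the Witt algebra are inner *)
Section Derivations.
Variables (K : numFieldType) (n : nat).
Local Notation W := (Der (laurent K n)).
Local Notation Z := 'rV[int]_n.
Implicit Types (x y z : W) (a b d : Z) (u v w : 'rV[K]_n) (D : W -> W).

Lemma homogD a u v : homog a (u + v) = homog a u + homog a v.
Proof. by have := homog_linear a 1 u v; rewrite !scale1r. Qed.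

Lemma homog0 a : homog a 0 = 0 :> W.
Proof. by apply: (addrI (homog a 0)); rewrite -homogD !addr0. Qed.

Lemma homogZ c a u : homog a (c *: u) = c *: homog a u.
Proof. by have := homog_linear a c u 0; rewrite homog0 !addr0. Qed.

Variable mu : 'rV[K]_n.
Hypothesis mu_gen : generic mu.
Local Notation dmu := (homog 0 mu).

Lemma generic_neq0 a : a != 0 -> dot mu a != 0.
Proof. by apply: contraNneq => /mu_gen ->. Qed.

(** The hypothesis says that t^a d_mu and t^b d_w commute. Pairing it with [a]
    gives <w, a> <mu, b - a> = 0, so <w, a> = 0, and then <mu, b> w = 0. *)
Lemma generic_commute a b w : b != 0 -> b != a ->
  dot mu b *: w = dot w a *: mu -> w = 0.
Proof.
move=> b0 ba h; have := congr1 (fun v => dot v a) h; rewrite /= !dotZl => /eqP.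
rewrite [dot w a * _]mulrC -subr_eq0 -mulrBl mulf_eq0.
rewrite -dotNr -dotDr (negbTE (generic_neq0 _)) ?subr_eq0 //= => /eqP wa.
move/eqP: h; rewrite wa scale0r scaler_eq0.
by rewrite (negbTE (generic_neq0 b0)) => /eqP.
Qed.

(** A derivation killing d_mu preserves the eigenspaces of ad d_mu, which are
    the homogeneous components. *)
Section DegreeZero.
Variable D : W -> W.
Hypotheses (hD : lie_derivation D) (D0 : D dmu = 0).

Let Dlie x y : D (lie x y) = lie (D x) y + lie x (D y).
Proof. by have [_ h] := hD; apply: h. Qed.

HB.instance Definition _ := GRing.isLinear.Build K W W *:%R D (proj1 hD).

(** The maps phi_a with D (t^a d_u) = t^a d_(phi_a u). *)
Definition weight_map a u := wcomp (D (homog a u)) a.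
Local Notation phi := weight_map.

Lemma derivation_homog a u : D (homog a u) = homog a (phi a u).
Proof.
apply: homog_of_wcomp => d da.
have := Dlie dmu (homog a u); rewrite D0 lie0l add0r lie_homog add0r dot0r.
rewrite scale0r subr0 homogZ linearZ /=.
move/(congr1 (fun y => wcomp y d)); rewrite wcompZ wcomp_lie_cartan => /eqP.
rewrite -subr_eq0 -scalerBl scaler_eq0 -dotNr -dotDr.
by rewrite (negbTE (generic_neq0 _)) ?subr_eq0 1?eq_sym // => /eqP.
Qed.

Lemma weight_map_linear a : linear (phi a).
Proof. by move=> c u v; rewrite /phi homog_linear linearP wcompD wcompZ. Qed.

HB.instance Definition _ a :=
  GRing.isLinear.Build K _ _ *:%R (phi a) (weight_map_linear a).

Lemma weight_map_lie a b u v :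
  phi (a + b) (dot u b *: v - dot v a *: u) =
    dot (phi a u) b *: v - dot v a *: phi a u
    + (dot u b *: phi b v - dot (phi b v) a *: u).
Proof.
rewrite {1}/phi -lie_homog Dlie !derivation_homog !lie_homog wcompD
  !wcomp_homog.
by rewrite eqxx.
Qed.

(** The derivation rule for d_u and t^a d_mu leaves <phi_0 u, a> mu = 0. *)
Lemma weight_map0 u : phi 0 u = 0.
Proof.
apply: dot_inj => a; have := weight_map_lie 0 a u mu.
rewrite add0r !dot0r !scale0r !subr0 linearZ /=.
rewrite -[LHS]add0r => /addIr /esym/eqP; rewrite scaler_eq0.
case/orP => /eqP // mu0; have [->|/generic_neq0] := eqVneq a 0.
  exact: dot0r.
by rewrite mu0 dot0l eqxx.
Qed.

(** From degrees [a] and [- a]: as phi_0 = 0, the derivation rule for t^a d_u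
    and t^(-a) d_(u0) with <u0, a> = 1 expresses phi_a u through u, u0 and
    phi_(-a) u0; pairing it with [a] removes the remaining unknown
    <phi_a u, a>. *)
Lemma weight_map_shape a : a != 0 ->
  exists l w, dot w a = 0 /\ forall u, phi a u = l *: u + dot u a *: w.
Proof.
move=> /(dot_surj K)[u0 u0a].
pose l := - dot (phi (- a) u0) a; pose w := - (l *: u0 + phi (- a) u0).
exists l, w; split=> [|u].
  by rewrite dotNl dotDl dotZl u0a mulr1 addNr oppr0.
have := weight_map_lie a (- a) u u0.
rewrite subrr weight_map0 !dotNr u0a !scale1r => /esym h.
have {}h : phi a u = l *: u - dot (phi a u) a *: u0 - dot u a *: phi (- a) u0.
  apply/eqP; rewrite -subr_eq0 -oppr_eq0 -{}h; apply/eqP.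
  by apply/rowP => i; rewrite !mxE /l; ring.
have e : dot (phi a u) a = l * dot u a.
  have := congr1 (fun v => dot v a) h.
  rewrite /= !(dotDl, dotNl, dotZl) u0a mulr1.
  have -> : dot (phi (- a) u0) a = - l by rewrite opprK.
  move=> e2.
  have : 2%:R * (dot (phi a u) a - l * dot u a) = 0.
    by rewrite mulrBr mulr_natl mulr2n {1}e2; ring.
  by move/eqP; rewrite mulf_eq0 pnatr_eq0 /= subr_eq0 => /eqP.
by rewrite h e /w; apply/rowP => i; rewrite !mxE; ring.
Qed.

(** If <u, b> = <v, a> = 0, then t^a d_u and t^b d_v commute, and the derivation
    rule becomes <phi_a u, b> v = <phi_b v, a> u. Its pairing with [a] kills
    the left side, so that both coefficients vanish. *)
Lemma weight_map_orth a b u v :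
  dot u a != 0 -> dot u b = 0 -> dot v a = 0 -> v != 0 ->
  dot (phi a u) b = 0.
Proof.
move=> ua ub va v0; have := weight_map_lie a b u v.
rewrite ub va !scale0r !subr0 linear0 add0r => h.
have := congr1 (fun w => dot w a) h.
rewrite /= dotDl dotNl dot0l !dotZl va mulr0 add0r => /esym/eqP.
rewrite oppr_eq0 mulf_eq0 (negbTE ua) orbF => /eqP e.
by move/esym/eqP: h; rewrite e scale0r subr0 scaler_eq0 (negbTE v0) orbF =>
  /eqP.
Qed.

(** The vector w of [weight_map_shape] vanishes: take u = e_i with a_i nonzero
    and b = e_j in [weight_map_orth], for each j other than i; the remaining
    coordinate w_i follows from <w, a> = 0. The value at a = 0 is fixed because
    phi_0 = 0 does not determine l when there are no nonzero vectors. *)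
Lemma weight_map_scalar a :
  exists l, (a = 0 -> l = 0) /\ forall u, phi a u = l *: u.
Proof.
have [->|a0] := eqVneq a 0.
  by exists 0; split=> // u; rewrite weight_map0 scale0r.
have [l [w [wa phiE]]] := weight_map_shape a0.
exists l; split=> [/eqP|u]; first by rewrite (negbTE a0).
rewrite phiE (_ : w = 0) ?scaler0 ?addr0 //.
have [i ai] := row_neq0 a0.
have ai' : (a 0 i)%:~R != 0 :> K by rewrite intr_eq0.
have wj j : j != i -> w 0 j = 0.
  move=> ji; rewrite -dot_unitv.
  have ij0 : dot (delta_mx 0 i : 'rV[K]_n) (unitv j) = 0.
    by rewrite dot_unitv mxE (negbTE ji) andbF.
  have := @weight_map_orth a (unitv j) (delta_mx 0 i)
    ((a 0 j)%:~R *: delta_mx 0 i - (a 0 i)%:~R *: delta_mx 0 j).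
  rewrite dot_delta ai' ij0 dotDl dotNl !dotZl !dot_delta => /(_ isT erefl).
  rewrite mulrC subrr phiE dotDl !dotZl ij0 mulr0 add0r dot_delta => h.
  apply: (mulfI ai'); rewrite mulr0; apply: h => //.
  apply/eqP => /rowP/(_ j); rewrite !mxE !eqxx (negbTE ji) mulr0 mulr1 add0r.
  by move/eqP; rewrite oppr_eq0 (negbTE ai').
apply/rowP => j; rewrite [RHS]mxE; have [->|/wj //] := eqVneq j i.
move: wa; rewrite /dot (bigD1 i) //= big1 ?addr0; last first.
  by move=> k /wj ->; rewrite mul0r.
by move/eqP; rewrite mulf_eq0 (negbTE ai') orbF => /eqP.
Qed.

(** With u = v = mu, the derivation rule gives
    (l(a+b) - l(a) - l(b)) <mu, b - a> = 0, hence additivity for distinct [a]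
    and [b]. Doubling follows from the two ways l(5a) = l(a) + l(4a) and
    l(5a) = l(2a) + l(3a) of computing the same value. *)
Lemma derivation_cartan :
  exists h, forall x, D x = lie (homog 0 h) x.
Proof.
have [l hl] := choice weight_map_scalar.
have lE a u : phi a u = l a *: u by have [_ ->] := hl a.
have l0 : l 0 = 0 by have [->] := hl 0.
have mu_neq0 a : a != 0 -> mu != 0.
  by move/generic_neq0; apply: contraNneq => ->; rewrite dot0l.
have lD_neq a b : a != b -> l (a + b) = l a + l b.
  move=> ab; have ba : b - a != 0 by rewrite subr_eq0 eq_sym.
  have := weight_map_lie a b mu mu; rewrite !lE !dotZl.
  move=> h; apply/eqP; rewrite -subr_eq0.
  have : (l (a + b) - (l a + l b)) * dot mu (b - a) *: mu == 0.
    rewrite dotDr dotNr -subr_eq0 subr0; move/eqP: h; rewrite -subr_eq0.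
    by apply: etrans; congr (_ == 0); apply/rowP => i; rewrite !mxE; ring.
  rewrite scaler_eq0 mulf_eq0 (negbTE (generic_neq0 ba)) orbF.
  by rewrite (negbTE (mu_neq0 _ ba)) orbF.
have lD a b : l (a + b) = l a + l b.
  have [<-|] := eqVneq a b; last exact: lD_neq.
  have [->|a0] := eqVneq a 0; first by rewrite addr0 l0 addr0.
  have lMn j k : j != k -> l (a *+ (j + k)) = l (a *+ j) + l (a *+ k).
    by move=> jk; rewrite mulrnDr lD_neq ?muln_neq.
  have l3 : l (a *+ 3) = l a + l (a *+ 2) := lMn 1%N 2%N isT.
  have l4 : l (a *+ 4) = l a + l (a *+ 3) := lMn 1%N 3%N isT.
  have l5 : l (a *+ 5) = l a + l (a *+ 4) := lMn 1%N 4%N isT.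
  have : l (a *+ 5) = l (a *+ 2) + l (a *+ 3) := lMn 2%N 3%N isT.
  rewrite l5 l4 l3 -mulr2n => e; apply/eqP; rewrite -subr_eq0; apply/eqP.
  rewrite (_ : _ - _ = l (a *+ 2) + (l a + l (a *+ 2))
             - (l a + (l a + (l a + l (a *+ 2))))); last by ring.
  by rewrite e subrr.
have lB : {morph l : a b / a - b}.
  by move=> a b; apply: (addIr (l b)); rewrite -lD !subrK.
pose lA : {additive Z -> K} := HB.pack l (GRing.isZmodMorphism.Build _ _ l lB).
exists (\row_i l (unitv i)) => x; have [S xE] := der_sum_homog x.
rewrite xE linear_sum; apply: wcomp_inj => d.
rewrite wcomp_lie_cartan !wcomp_sum scaler_sumr; apply: eq_bigr => a _.
rewrite /= derivation_homog !wcomp_homog lE; case: eqP => [->|_];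
  last by rewrite scaler0.
rewrite -[l a]/(lA a) additive_rowE; congr (_ *: _); apply: eq_bigr => i _.
by rewrite mxE -mulrzr.
Qed.
End DegreeZero.

(** The components of D(d_mu) of nonzero degree are removed by an inner
    derivation, since ad d_mu is invertible there. What remains of D(d_mu) is
    some d_k, and the derivation rule for d_mu and t^a d_mu gives <k, a> = 0
    for every [a]. *)
Lemma derivation_inner D : lie_derivation D -> exists g, forall x, D x = lie g
  x.
Proof.
move=> hD; pose c a := - (dot mu a)^-1 *: wcomp (D dmu) a.
have [S hS] := wcomp_finite (D dmu).
pose g0 : W := \sum_(a <- undup S) homog a (c a).
have g0E : wcomp g0 =1 c.
  apply: wcomp_sum_homog => a ca; apply: hS; apply: contraNneq ca => e.
  by rewrite /c e scaler0.
have [D1 [D1E hD1]] : exists D1, (forall x, D1 x = D x - lie g0 x) /\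
  lie_derivation D1.
  by exists (fun x => D x - lie g0 x); split=> //;
    apply/lie_derivationB/lie_derivation_ad.
have D1lie x y : D1 (lie x y) = lie (D1 x) y + lie x (D1 y).
  by have [_ h] := hD1; apply: h.
have D1Z k x : D1 (k *: x) = k *: D1 x.
  pose D1l : {linear W -> W} := HB.pack D1 (GRing.isLinear.Build _ _ _ _ D1
    (proj1 hD1)).
  by rewrite -[D1 _]/(D1l _) linearZ.
have D1mu : D1 dmu = homog 0 (wcomp (D1 dmu) 0).
  apply: homog_of_wcomp => d d0;
    rewrite D1E lie_anti opprK wcompD wcomp_lie_cartan g0E.
  by rewrite scalerA mulrN divff ?generic_neq0 // scaleN1r subrr.
set k := wcomp _ _ in D1mu.
have {}D1mu : D1 dmu = 0.
  rewrite D1mu (_ : k = 0) ?homog0 //; apply: dot_inj => a.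
  have [->|a0] := eqVneq a 0; first exact: dot0r.
  have := D1lie dmu (homog a mu); rewrite D1mu !lie_homog !add0r !dot0r.
  rewrite !scale0r !subr0 homogZ D1Z => /(congr1 (fun x => wcomp x a)).
  rewrite wcompZ wcompD wcomp_lie_cartan wcomp_homog eqxx -[LHS]add0r =>
    /addIr/esym/eqP.
  rewrite scaler_eq0 => /orP[/eqP //|/eqP m0].
  by have := generic_neq0 a0; rewrite m0 dot0l eqxx.
have [h hE] := derivation_cartan hD1 D1mu.
by exists (homog 0 h + g0) => x; rewrite lieDl -hE D1E subrK.
Qed.

(** * Test elements *)
Definition test_elt a : W := dmu + homog a mu.

Lemma wcomp_lie_test a x d : wcomp (lie (test_elt a) x) d =
  dot mu d *: wcomp x d
  + (dot mu (d - a) *: wcomp x (d - a) - dot (wcomp x (d - a)) a *: mu).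
Proof. by rewrite lieDl wcompD wcomp_lie_cartan wcomp_lie_homog. Qed.

(** In degree d the equation relates the components of [g] of degrees d and
    d - a only, so that it lives on the lines d + Z a. A vanishing component
    spreads along such a line in both directions, except past the degrees 0
    and a; by finite support [g] lives in these two degrees, where the
    equation is solved directly. *)
Lemma test_elt_centralizer a g l : a != 0 ->
  lie g (test_elt a) = l *: homog a mu ->
  exists c h, g = c *: test_elt a + homog 0 h /\ dot h a = l.
Proof.
move=> a0 gy.
have ma := generic_neq0 a0.
have eqn d : dot mu d *: wcomp g d
    + (dot mu (d - a) *: wcomp g (d - a) - dot (wcomp g (d - a)) a *: mu)
    = if d == a then - l *: mu else 0.
  rewrite -wcomp_lie_test lie_anti gy -scaleNr wcompZ wcomp_homog.
  by case: eqP => // _; rewrite scaler0.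
(* In degree d + a, only the bracket of t^a d_mu with the component of [g] of
   degree d is left. *)
have up d : d != 0 -> d != a -> wcomp g (d + a) = 0 -> wcomp g d = 0.
  move=> d0 da gda; have := eqn (d + a).
  rewrite addrK gda scaler0 add0r -[X in _ == X]add0r (inj_eq (addIr _))
    (negbTE d0).
  by move/eqP; rewrite subr_eq0 => /eqP; apply: generic_commute.
have down d : d != 0 -> d != a -> wcomp g (d - a) = 0 -> wcomp g d = 0.
  move=> d0 da gda; have := eqn d;
    rewrite gda dot0l scale0r scaler0 subrr addr0.
  by rewrite (negbTE da) => /eqP;
    rewrite scaler_eq0 (negbTE (generic_neq0 d0)) => /eqP.
have supp d : d != 0 -> d != a -> wcomp g d = 0.
  move=> d0 da.
  have descend b : b != 0 ->
      (forall k, wcomp g (d + b *+ k + b) = 0 -> wcomp g (d + b *+ k) = 0) ->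
        wcomp g d = 0.
    move=> /(wcomp_string g d)[N hN] step; rewrite -[d]addr0 -(mulr0n b).
    elim: N hN => [|N IH] hN; first exact: hN.
    apply: IH => k; rewrite leq_eqVlt => /predU1P[<-|/hN //].
    by apply: step; rewrite -addrA -mulrSr; apply: hN.
  (* One of the half-lines d + N a and d - N a avoids both 0 and a: otherwise
     d would lie between them on its line, hence be one of them. *)
  have [off|on] := pselect (forall k (e : bool), d + a *+ k <> a *+ e).
    apply: (descend a) => // k; apply: up; apply/eqP.
      exact: (off k false).
    exact: (off k true).
  apply: (descend (- a)); rewrite ?oppr_eq0 // => k.
  have off (e : bool) : d + - a *+ k <> a *+ e.
    rewrite mulNrn => /eqP; rewrite subr_eq -mulrnDr => /eqP dE.
    apply: on => j e'; rewrite dE -mulrnDr; apply/eqP/muln_neq => //.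
    move: d0 da; rewrite {}dE; case: e => /=; case: k => [|[|k]] //=;
      rewrite ?eqxx //; case: e' => //.
  by apply: down; apply/eqP; [exact: (off false) | exact: (off true)].
have ga : wcomp g a = (dot (wcomp g a) a / dot mu a) *: mu.
  have aa : a + a != a by rewrite -subr_eq0 addrK.
  have := eqn (a + a); rewrite addrK (negbTE aa) (supp (a + a)) //.
    rewrite scaler0 add0r => /eqP; rewrite subr_eq0 => /eqP e.
    by rewrite mulrC -scalerA -e scalerA mulVf // scale1r.
  by have := muln_neq a0 (isT : 2%N != 0%N); rewrite mulr0n mulr2n.
set c := _ / _ in ga; exists c, (wcomp g 0 - c *: mu); split.
  apply: wcomp_inj => d; rewrite wcompD wcompZ wcompD !wcomp_homog.
  have [->|d0] := eqVneq d 0;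
    first by rewrite eq_sym (negbTE a0) addr0 addrC subrK.
  have [->|da] := eqVneq d a; first by rewrite add0r addr0.
  by rewrite !addr0 scaler0 supp.
have := eqn a; rewrite eqxx subrr dot0r scale0r add0r ga => /eqP.
rewrite scalerA -scalerBl -subr_eq0 -scalerBl scaler_eq0 => /orP[|/eqP m0].
  rewrite dotDl dotNl dotZl => /eqP e; apply/eqP; rewrite -subr_eq0 -oppr_eq0.
  by rewrite -e; apply/eqP; ring.
by move: ma; rewrite m0 dot0l eqxx.
Qed.

End Derivations.

(** * 2-local derivations *)
Section TwoLocal.
Variables (K : numFieldType) (n : nat).
Local Notation W := (Der (laurent K n)).
Local Notation Z := 'rV[int]_n.
Implicit Types (x y z : W) (a b d : Z) (u v w : 'rV[K]_n).
Variable mu : 'rV[K]_n.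
Hypothesis mu_gen : generic mu.
Local Notation dmu := (homog 0 mu).

Section Normalized.
Variable Delta : W -> W.
Hypotheses (hDelta : two_local_derivation Delta) (Delta0 : Delta dmu = 0).

Lemma two_local_diag x :
  exists h, forall a, wcomp (Delta x) a = dot h a *: wcomp x a.
Proof.
have [D [hD Dx Dmu]] := hDelta x dmu.
have [h hE] := derivation_cartan mu_gen hD (etrans (esym Dmu) Delta0).
by exists h => a; rewrite Dx hE wcomp_lie_cartan.
Qed.

Lemma two_local_test a : exists l, Delta (test_elt mu a) = l *: homog a mu.
Proof.
have [h hE] := two_local_diag (test_elt mu a); exists (dot h a).
apply: wcomp_inj => d; rewrite hE wcompD wcompZ !wcomp_homog.
have [->|d0] := eqVneq d 0.
  rewrite dot0r scale0r; case: eqP => [<-|_]; last by rewrite scaler0.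
  by rewrite dot0r scale0r.
by rewrite add0r; case: eqP => [->|_] //; rewrite !scaler0.
Qed.

(** The multiplier of degree [b] can be read, up to the factor k, on the test
    element of degree kb, which does not depend on [x]; only the bound on k
    does. *)
Lemma two_local_rate : exists rate : Z -> nat -> K, forall x b, b != 0 ->
  exists N, forall k, (N <= k)%N -> wcomp (Delta x) b = rate b k *: wcomp x b.
Proof.
have [l lE] := choice two_local_test.
exists (fun b k => l (b *+ k) / k%:R) => x b b0.
have [hx hxE] := two_local_diag x.
have [xb|xb] := eqVneq (wcomp x b) 0.
  by exists 0%N => k _; rewrite hxE xb !scaler0.
have [N hN] := wcomp_string x 0 b0.
have {}hN k : (N <= k)%N -> wcomp x (b *+ k) = 0 by move/hN; rewrite add0r.
have N1 : (1 < N)%N.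
  by rewrite ltnNge; apply: contraNN xb => /hN; rewrite mulr1n => ->.
exists N => k Nk; have k0 : (0 < k)%N by rewrite (leq_trans _ Nk) // ltnW.
set a := b *+ k; have a0 : a != 0 by rewrite -(mulr0n b) muln_neq // -lt0n.
have [D [hD Dx Dy]] := hDelta x (test_elt mu a).
have [g gE] := derivation_inner mu_gen hD.
have [c [h [gch ha]]] : exists c h,
    g = c *: test_elt mu a + homog 0 h /\ dot h a = l a.
  by apply: (test_elt_centralizer mu_gen) => //; rewrite -gE -Dy lE.
have eqn d : dot hx d *: wcomp x d = c *: wcomp (lie (test_elt mu a) x) d + dot
  h d *: wcomp x d.
  by rewrite -hxE Dx gE gch lieDl lieZl wcompD wcompZ wcomp_lie_cartan.
have c0 : c = 0.
  (* In degree mb + kb, with mb the last multiple of b occurring in x, the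
     only contribution to [g, x] comes from c t^(kb) d_mu. *)
  have ex : exists m, wcomp x (b *+ m) != 0 by exists 1%N; rewrite mulr1n.
  have ub m : wcomp x (b *+ m) != 0 -> (m <= N)%N.
    by apply: contraNleq => /ltnW/hN ->.
  have [m xm mmax] := ex_maxnP ex ub.
  have m0 : (0 < m)%N by apply: mmax; rewrite mulr1n.
  have mN : (m < N)%N by rewrite ltnNge; apply: contraNN xm => /hN ->.
  apply/eqP; apply: contraNT xm => cn0; apply/eqP.
  apply: (generic_commute mu_gen (a := a) (b := b *+ m)).
  - by rewrite -(mulr0n b) muln_neq // -lt0n.
  - by rewrite muln_neq // ltn_eqF // (leq_trans mN).
  have := eqn (b *+ m + a); rewrite wcomp_lie_test addrK.
  rewrite (_ : wcomp x (b *+ m + a) = 0); last first.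
    by rewrite -mulrnDr hN // (leq_trans Nk) // leq_addl.
  rewrite !scaler0 addr0 add0r => /esym/eqP.
  by rewrite scaler_eq0 (negbTE cn0) subr_eq0 => /eqP.
have := eqn b; rewrite c0 scale0r add0r hxE => ->.
by rewrite -ha dotMnr mulrAC divff ?mul1r // pnatr_eq0 -lt0n.
Qed.

(** Since x_1 = sum_i t^(e_i) d_mu determines h on the unit vectors, and
    t^b d_mu + x_1 shares its multipliers there, the multiplier of degree [b] is
    also given by h. The coefficients are nonnegative integer multiples of mu,
    so that no cancellation occurs when [b] is itself a unit vector. *)
Lemma two_local_inner : exists h, Delta = lie (homog 0 h).
Proof.
have [rate rateE] := two_local_rate.
have transfer x h y b : (forall a, wcomp (Delta x) a = dot h a *: wcomp x a) ->
    wcomp x b != 0 -> wcomp (Delta y) b = dot h b *: wcomp y b.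
  move=> hE xb; have [->|b0] := eqVneq b 0.
    by have [g ->] := two_local_diag y; rewrite !dot0r !scale0r.
  have [N hN] := rateE x b b0; have [M hM] := rateE y b b0.
  rewrite (hM (maxn N M)) ?leq_maxr //; congr (_ *: _).
  have /eqP := hN (maxn N M) (leq_maxl _ _).
  by rewrite hE -subr_eq0 -scalerBl scaler_eq0 (negbTE xb) orbF subr_eq0 =>
    /eqP.
pose x1 : W := \sum_i homog (unitv i) mu.
have x1E a : wcomp x1 a = (\sum_i (a == unitv i))%N%:R *: mu.
  rewrite wcomp_sum natr_sum scaler_suml; apply: eq_bigr => i _.
  by rewrite wcomp_homog; case: eqP => _; rewrite ?scale1r ?scale0r.
have x2E b a : wcomp (homog b mu + x1) a = ((a == b) + \sum_i (a == unitv
  i))%N%:R *: mu.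
  rewrite wcompD x1E wcomp_homog natrD scalerDl; congr (_ + _).
  by case: eqP => _; rewrite ?scale1r ?scale0r.
have unit_pos (i : 'I_n) : (0 < \sum_j (unitv i == unitv j))%N.
  by rewrite (bigD1 i) //= eqxx.
have [h hE] := two_local_diag x1; exists h; apply/funext => y.
apply: wcomp_inj => b; rewrite wcomp_lie_cartan.
have [->|b0] := eqVneq b 0.
  by have [g ->] := two_local_diag y; rewrite !dot0r !scale0r.
have mu0 : mu != 0.
  by apply: contraNneq (generic_neq0 mu_gen b0) => ->; rewrite dot0l.
have scale_mu m : (0 < m)%N -> m%:R *: mu != 0.
  by move=> m0; rewrite scaler_eq0 (negbTE mu0) orbF pnatr_eq0 -lt0n.
have [h2 h2E] := two_local_diag (homog b mu + x1).
have -> : h = h2.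
  apply/rowP => i; rewrite -!dot_unitv.
  have : wcomp (homog b mu + x1) (unitv i) != 0.
    by rewrite x2E scale_mu // ltn_addl.
  move/(transfer _ _ x1 _ h2E)/eqP; rewrite hE -subr_eq0 -scalerBl scaler_eq0.
  by rewrite x1E (negbTE (scale_mu _ (unit_pos i))) orbF subr_eq0 => /eqP.
by apply: transfer h2E _; rewrite x2E eqxx scale_mu.
Qed.
End Normalized.

Lemma two_local_is_derivation (Delta : W -> W) :
  two_local_derivation Delta -> lie_derivation Delta.
Proof.
move=> hDelta; have [D [hD Dmu _]] := hDelta dmu dmu.
have h2 : two_local_derivation (fun x => Delta x - D x).
  move=> x y; have [E [hE -> ->]] := hDelta x y.
  by exists (fun z => E z - D z); split=> //; apply: lie_derivationB.
have [|h hE] := two_local_inner h2; first by rewrite Dmu subrr.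
rewrite (_ : Delta = fun x => lie (homog 0 h) x + D x).
  exact: lie_derivationD (lie_derivation_ad _) hD.
by apply/funext => x; rewrite -hE subrK.
Qed.
End TwoLocal.

(** * Existence of generic vectors *)
Section GenericVector.
Variable R : realType.

(** Nested intervals: at step k, keep the lower or the upper third, whichever
    avoids f k; the supremum of the left ends lies in all of them. *)
Lemma real_uncountable (f : nat -> R) : exists x, forall k, f k != x.
Proof.
pose step k (I : R * R) := let: (a, b) := I in
  if f k <= (a + b) / 2%:R then ((a + b *+ 2) / 3%:R, b) else (a, (a *+ 2 + b)
    / 3%:R).
pose I := fix I k := if k is k'.+1 then step k' (I k') else (0 : R, 1 : R).
have Ilt k : (I k).1 < (I k).2.
  elim: k => [|k IH] /=; first exact: ltr01.
  rewrite /step; case: (I k) IH => a b /= ab; case: ifP => _ /=; lra.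
have Istep k : (I k).1 <= (I k.+1).1 /\ (I k.+1).2 <= (I k).2.
  move: (Ilt k) => /=; rewrite /step; case: (I k) => a b /= ab.
  by case: ifP => _ /=; split; lra.
have Iavoid k : f k < (I k.+1).1 \/ (I k.+1).2 < f k.
  move: (Ilt k) => /=; rewrite /step; case: (I k) => a b /= ab.
  by case: (leP (f k) ((a + b) / 2%:R)) => fk; [left|right] => /=; lra.
have Imono j k : (j <= k)%N -> (I j).1 <= (I k).1 /\ (I k).2 <= (I j).2.
  elim: k => [|k IH]; first by rewrite leqn0 => /eqP ->.
  rewrite leq_eqVlt => /predU1P[-> //|/IH[h1 h2]].
  by have [h3 h4] := Istep k; split; [exact: le_trans h3|exact: le_trans h2].
have cross j k : (I j).1 <= (I k).2.
  have [/Imono[h _]|/ltnW/Imono[_ h]] := leqP j k.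
    exact: le_trans h (ltW (Ilt k)).
  exact: le_trans (ltW (Ilt j)) h.
pose S (y : R) : Prop := exists k, y = (I k).1.
have Ssup : has_sup S.
  split; first by exists (I 0%N).1, 0%N.
  by exists (I 0%N).2 => _ [k ->]; exact: cross.
exists (sup S) => k; apply/eqP => fk.
have lo : (I k.+1).1 <= sup S by apply: (ub_le_sup Ssup.2); exists k.+1.
have hi : sup S <= (I k.+1).2 by apply: (ge_sup Ssup.1) => _ [j ->];
  exact: cross.
by have [] := Iavoid k; rewrite fk ltNge ?lo ?hi.
Qed.

(** An integer relation between the powers of s makes s a root of a nonzero
    integer polynomial, and the real roots of these polynomials can be
    enumerated. *)
Lemma exists_generic n : exists mu : 'rV[R[i]]_n, generic mu.
Proof.
pose p (a : 'rV[int]_n) : {poly R} := \sum_(i < n) (a 0 i)%:~R *: 'X^i.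
pose f k := if (choice.unpickle k : option ('rV[int]_n * nat)) is Some (a, j)
  then (rootsR (p a))`_j else 0.
have [s hs] := real_uncountable f.
exists (\row_i (s ^+ i)%:C%C) => a.
have -> : dot (\row_i (s ^+ i)%:C%C) a = ((p a).[s])%:C%C.
  rewrite horner_sum rmorph_sum; apply: eq_bigr => i _.
  by rewrite mxE hornerZ hornerXn rmorphM mulrC /= rmorph_int.
move=> /eqP; rewrite (fmorph_eq0 (real_complex R)) => ps.
have pa0 : p a = 0.
  apply/eqP; apply: contraT => pa.
  have : s \in rootsR (p a) by rewrite -(roots_on_rootsR pa) in_itv.
  move=> /(nthP 0)[j _ js].
  by have := hs (choice.pickle (a, j)); rewrite /f choice.pickleK js eqxx.
apply/rowP => i; rewrite mxE; have := congr1 (fun q : {poly R} => q`_i) pa0.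
rewrite /= coef0 coef_sum (bigD1 i) //= coefZ coefXn eqxx mulr1 big1 ?addr0.
  by move/eqP; rewrite intr_eq0 => /eqP.
by move=> j ji; rewrite coefZ coefXn eq_sym (negbTE ji : (j == i :> nat) =
  false) mulr0.
Qed.
End GenericVector.

Local Close Scope ring_scope.

Theorem theorem3p1 (R : realType) (n : nat) (hn : 1 <= n)
  (Delta : witt R n -> witt R n) (hDelta : two_local_derivation Delta) :
  lie_derivation Delta.
Proof.
have [mu mu_gen] := exists_generic R n.
exact: (two_local_is_derivation mu_gen hDelta).
Qed.
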